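(* If $f : \mathcal{C}_d \to \mathbb{R}^+ \cup \{\infty\}$ is monotone, can be approximated by inscribed polytopes, and admits a selection theorem, then for any $1 > \varepsilon' > 0$, $f$ admits bounded weak $\varepsilon'$-nets for convex sets.
   Context: $\mathbb{R}^+ = \{a \in \mathbb{R} : a \ge 0\}$ and $\mathcal{C}_d$ is the family of convex sets in $\mathbb{R}^d$. A function $f : \mathcal{C}_d \to \mathbb{R}^+ \cup \{\infty\}$ is monotone if $A \subset B$ implies $f(A) \le f(B)$. For a family $A$ of sets, $\bigcup A$ is the union of its members. $f$ can be approximated by inscribed polytopes if for every $1 > \varepsilon > 0$ there is a constant $C(f,d,\varepsilon)$ such that for every $\infty > \lambda \ge 0$ and every convex set $K \subset \mathbb{R}^d$ with $f(K) \ge \lambda$, there is a polytope $P \subset K$ with at most $C(f,d,\varepsilon)$ vertices such that $f(P) \ge (1-\varepsilon)\lambda$. For such $f$ let $r(f,d,\varepsilon) = \max\{d \cdot C(f,d,\frac{\varepsilon}{2}),\, d+1\}$. Then $f$ admits a selection theorem if for any $1 > \varepsilon > 0$ there is a constant $\rho = \rho(f,d,\varepsilon) > 0$ such that for any $\lambda > 0$ and any finite family $\mathcal{T}$ of convex sets in $\mathbb{R}^d$, if $f(T) \ge \lambda$ for all $T \in \mathcal{T}$, there is a convex set $T_0$ with $f(T_0) \ge \lambda(1-\varepsilon)$ such that $T_0 \subset \mathrm{conv}(\bigcup A)$ for at least $\rho\binom{|\mathcal{T}|}{r(f,d,\varepsilon)}$ subsets $A \subset \mathcal{T}$ of cardinality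 $r(f,d,\varepsilon)$. Given $1 > \varepsilon' > 0$, $f$ admits bounded weak $\varepsilon'$-nets for convex sets if for every $1 > \varepsilon > 0$ there is a constant $m = m(f,d,\varepsilon,\varepsilon')$ such that for every $\lambda > 0$ and every finite family $\mathcal{T}$ of convex sets in $\mathbb{R}^d$ with $f(T) \ge \lambda$ for all $T \in \mathcal{T}$, there is a family $\mathcal{T}_0$ of at most $m$ convex sets in $\mathbb{R}^d$ with $f(T_0) \ge (1-\varepsilon)\lambda$ for all $T_0 \in \mathcal{T}_0$, such that for every subset $A \subset \mathcal{T}$ of cardinality at least $\varepsilon'|\mathcal{T}|$ there is at least one set of $\mathcal{T}_0$ contained in $\mathrm{conv}(\bigcup A)$.
   Formalization: The finite families of convex sets, in both the selection theorem and the weak-net property, are taken to be nonempty; for the empty family the weak-net condition would require a subset of conv(∅) = ∅ with positive f, which fails e.g. for length on the line. *)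

(* Defs.v *)
From mathcomp Require Import all_boot all_order all_algebra finmap.
From mathcomp Require Import all_classical all_reals all_analysis.

Set Implicit Arguments.
Unset Strict Implicit.
Unset Printing Implicit Defensive.

Import Order.TTheory GRing.Theory Num.Theory.

Local Open Scope fset_scope.
Local Open Scope classical_set_scope.
Local Open Scope ring_scope.

Section Definitions.
Variables (R : realType) (d : nat).

Local Notation E := 'rV[R]_d.

(* A function on the family of convex sets of R^d is encoded as a function
   f : set E -> \bar R; every definition below constrains or evaluates f on
   convex sets only, so its values elsewhere are irrelevant. *)
Implicit Types (f : set E -> \bar R) (C : R -> nat) (K P : set E).
Implicit Types T A N : {fset (set E)}.

Definition isconvex K : Prop := @convex_set R E K.

Definition convex_hull (X : set E) : set E := smallest isconvex X.

Definition convU A : set E := convex_hull (\bigcup_(K in [set` A]) K).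

Definition nonneg_on_convex f : Prop :=
  forall K, isconvex K -> (0 <= f K)%E.

Definition monotone_on_convex f : Prop :=
  forall K L : set E, isconvex K -> isconvex L -> K `<=` L -> (f K <= f L)%E.

Definition is_polytope P : Prop :=
  exists V : {fset E}, P = convex_hull [set` V].

(* The vertices of a polytope are its extreme points. *)
Definition vertices P : set E :=
  [set v | P v /\ forall (x y : E) (t : R), P x -> P y -> 0 < t < 1 ->
                    v = t *: x + (1 - t) *: y -> x = y].

(* C eps is the constant C(f, d, eps). It is an argument, not existentially
   quantified, because the cardinality r(f, d, eps) of the subfamilies in the
   selection theorem is computed from it. *)
Definition approximated_by_inscribed_polytopes f C : Prop :=
  forall eps : R, 0 < eps < 1 ->
  forall lambda : R, 0 <= lambda ->
  forall K, isconvex K -> (lambda%:E <= f K)%E ->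
  exists P, [/\ is_polytope P, P `<=` K, (vertices P #<= `I_(C eps))%card
             & (((1 - eps) * lambda)%:E <= f P)%E].

Definition selection_size C (eps : R) : nat :=
  maxn (d * C (eps / 2))%N d.+1.

Definition is_family_above f (lambda : R) T : Prop :=
  forall K, K \in T -> isconvex K /\ (lambda%:E <= f K)%E.

(* Families are nonempty here and in the next definition. The empty family
   satisfies any lower bound on f vacuously, so allowing it in the next
   definition would require (1 - eps) * lambda <= f set0 for all lambda. *)
Definition admits_selection_theorem f C : Prop :=
  forall eps : R, 0 < eps < 1 ->
  exists2 rho : R, 0 < rho &
  forall lambda : R, 0 < lambda ->
  forall T, T != fset0 -> is_family_above f lambda T ->
  exists K0 : set E,
    [/\ isconvex K0, ((lambda * (1 - eps))%:E <= f K0)%E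
      & rho * 'C(#|` T|, selection_size C eps)%:R <=
        #|` [fset A in fpowerset T |
               (#|` A| == selection_size C eps) &&
               `[< K0 `<=` convU A >]]|%:R].

Definition admits_bounded_weak_nets f (eps' : R) : Prop :=
  forall eps : R, 0 < eps < 1 ->
  exists m : nat,
  forall lambda : R, 0 < lambda ->
  forall T, T != fset0 -> is_family_above f lambda T ->
  exists N, [/\ (#|` N| <= m)%N,
                is_family_above f ((1 - eps) * lambda) N
              & forall A, (A `<=` T)%fset -> eps' * #|` T|%:R <= #|` A|%:R ->
                exists2 K0 : set E, K0 \in N & K0 `<=` convU A].

End Definitions.

(* Main.v *)
Require Import Defs.
From mathcomp Require Import all_boot all_order all_algebra finmap.
From mathcomp Require Import all_classical all_reals all_analysis.

(** The net is built greedily.  Let [n] be the size of the family [T] and [r]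
    the cardinality of the subfamilies in the selection theorem.  As long as
    some subfamily [A] of at least [eps' * n] sets has no net member inside
    [convU A], the selection theorem applied to [A] gives a convex set that lies
    in [convU B] for at least [rho * 'C(#|` A|, r)] of the [r]-subsets [B] of
    [A]; add it to the net.  None of these [B] had a net member inside [convU B]
    before, because [convU B] is contained in [convU A].  So each step exhausts
    new [r]-subsets of [T], and their number is a fixed fraction of
    ['C(n, r)], because a dense [A] contains a fixed fraction of all [r]-subsets
    ([bin_dense]).  There are only ['C(n, r)] of them, hence the number of steps
    is bounded independently of [T] ([greedy_net]).

    This needs [r <= eps' * n], which makes [r]-subsets of [A] available.
    Otherwise [n] itself is less than [r / eps'], and [T] is its own net: every
    nonempty [A] has a member, and it lies in [convU A]. *)

Import Order.TTheory GRing.Theory Num.Theory.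

Local Open Scope ring_scope.

(** * Counting subsets of a given cardinality *)

Lemma card_fpowerset_draws (K : choiceType) (T : {fset K}) (r : nat) :
  #|` [fset A in fpowerset T | #|` A| == r]%fset| = 'C(#|` T|, r).
Proof.
rewrite [#|` T|]cardfE -card_draws.
have -> : [fset A in fpowerset T | #|` A| == r]%fset =
    [fset [fsetval y in (Y : {set T})]
       | Y in [set Y : {set T} | #|Y| == r]%SET]%fset.
  apply/fsetP => A; rewrite !inE fpowersetE /=.
  apply/andP/imfsetP => [[AT /eqP Ar]|[Y /= Yr ->]].
    exists (fsub T A); last by rewrite fsubK.
    by rewrite inE card_fsub // Ar.
  have YT : ([fsetval y in Y] `<=` T)%fset by apply: fset_sub_val.
  by split=> //; rewrite -(card_fsub YT) FSetK; rewrite inE in Yr.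
rewrite card_in_imfset /= ?cardE // => X Y _ _ XY.
by rewrite -(FSetK X) XY FSetK.
Qed.

Lemma bin_le_exp (n r : nat) : ('C(n, r) <= n ^ r)%N.
Proof.
rewrite (leq_trans (leq_pmulr _ (fact_gt0 r))) // bin_ffact ffact_prod.
have -> : (n ^ r = \prod_(i < r) n)%N by rewrite prod_nat_const card_ord.
by apply: leq_prod => i _; apply: leq_subr.
Qed.

(** ['C(a, r)] is the product of the fractions [(a - i) / (r - i)], each of
    which is at least [a / r]. *)
Lemma exp_le_bin (a r : nat) : (r <= a -> a ^ r <= r ^ r * 'C(a, r))%N.
Proof.
move=> ra; rewrite -(leq_pmul2r (fact_gt0 r)) -mulnA bin_ffact -ffactnn.
rewrite !ffact_prod.
have expE b : (b ^ r = \prod_(i < r) b)%N by rewrite prod_nat_const card_ord.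
rewrite !expE -!big_split /=; apply: leq_prod => i _.
by rewrite !mulnBr [(r * a)%N]mulnC leq_sub2l // leq_mul2r ra orbT.
Qed.

Lemma bin_dense (R : realFieldType) (e : R) (n a r : nat) :
  0 < e -> (0 < r <= a)%N -> e * n%:R <= a%:R ->
  (e / r%:R) ^+ r * 'C(n, r)%:R <= 'C(a, r)%:R.
Proof.
move=> e0 /andP[r0 ra] ena.
have rr0 : 0 < r%:R ^+ r :> R by rewrite exprn_gt0 // ltr0n.
rewrite expr_div_n mulrAC ler_pdivrMr //.
apply: (@le_trans _ _ (e ^+ r * n%:R ^+ r)).
  by rewrite ler_pM2l ?exprn_gt0 // -natrX ler_nat bin_le_exp.
rewrite -exprMn; apply: (@le_trans _ _ (a%:R ^+ r)).
  by rewrite lerXn2r ?nnegrE // mulr_ge0 // ltW.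
by rewrite -!natrX -natrM ler_nat mulnC exp_le_bin.
Qed.

(** * Greedy construction of nets *)

(** A heavy [A] not hit by the current net contains no hit member of [U], by
    monotonicity of [hit].  Adding the point selected for [A] therefore hits
    [delta * #|` U|] new members of [U], which can happen at most [1 / delta]
    times. *)
Lemma greedy_net (R : realFieldType) (I K : choiceType)
    (hit : I -> {fset K} -> Prop) (good : I -> Prop) (heavy : {fset K} -> Prop)
    (U : {fset {fset K}}) (delta : R) (m : nat) :
  (forall i (A B : {fset K}), (A `<=` B)%fset -> hit i A -> hit i B) ->
  (0 < #|` U|)%N -> 1 < delta * m%:R ->
  (forall A, heavy A -> exists2 i, good i &
     delta * #|` U|%:R
       <= #|` [fset B in U | (B `<=` A)%fset && `[< hit i B >]]%fset|%:R) ->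
  exists N : {fset I}, [/\ (#|` N| <= m)%N, forall i, i \in N -> good i &
    forall A, heavy A -> exists2 i, i \in N & hit i A].
Proof.
move=> hit_mono U0 m_big select.
pose net (N : {fset I}) := forall A, heavy A -> exists2 i, i \in N & hit i A.
pose hitU (N : {fset I}) :=
  [fset B in U | `[< exists2 i, i \in N & hit i B >]]%fset.
have step k : exists N : {fset I}, [/\ (#|` N| <= k)%N,
    forall i, i \in N -> good i &
    net N \/ delta * k%:R * #|` U|%:R <= #|` hitU N|%:R].
  elim: k => [|k [N [Nk Ngood Nnet]]].
    by exists fset0; split; rewrite ?cardfs0 //; right; rewrite mulr0 mul0r.
  have [Nn|Nn] := pselect (net N).
    by exists N; split=> //; [exact: leqW | left].
  case: Nnet => // hitN.
  have /existsNP[A /not_implyP[Aheavy Anohit]] := Nn.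
  have [i igood ihit] := select _ Aheavy.
  set new := [fset B in U | _]%fset in ihit.
  exists (i |` N)%fset; split.
  - by rewrite cardfsU1 -add1n leq_add // leq_b1.
  - by move=> j /fset1UP[->//|]; apply: Ngood.
  right.
  have disj : [disjoint hitU N & new]%fset.
    apply/fdisjointP => B; rewrite !inE /= => /andP[BU /asboolP[j jN jB]].
    apply/negP => /andP[_ /andP[BA _]]; apply: Anohit.
    by exists j => //; apply: hit_mono BA jB.
  have sub : (hitU N `|` new `<=` hitU (i |` N))%fset.
    apply/fsubsetP => B; rewrite !inE /= => /orP[|] /andP[->] /=.
      by move=> /asboolP[j jN jB]; apply/asboolP; exists j; rewrite // fset1Ur.
    move=> /andP[_ /asboolP iB]; apply/asboolP; exists i => //.
    exact: fset1U1.
  have := fsubset_leq_card sub; rewrite cardfsU (eqP disj) cardfs0 subn0.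
  rewrite -(ler_nat R) natrD; apply: le_trans.
  by rewrite -natr1 mulrDr mulr1 mulrDl lerD.
have [N [Nm Ngood [Nnet|hitN]]] := step m; first by exists N.
have : (#|` hitU N| <= #|` U|)%N by apply: fsubset_leq_card; exact: fset_sub.
rewrite -(ler_nat R) => /(le_trans hitN).
by rewrite -ler_pdivlMr ?divff ?ltr0n ?gt_eqF ?ltr0n // leNgt m_big.
Qed.

(** * Weak nets from a selection theorem *)

Lemma subset_convU (R : realType) (d : nat) (A B : {fset (set 'rV[R]_d)}) :
  (A `<=` B)%fset -> (convU A `<=` convU B)%classic.
Proof.
move=> /fsubsetP AB x Ax M [Mc BM]; apply: Ax; split=> //.
by move=> y [K /= KA Ky]; apply: BM; exists K => //=; apply: AB.
Qed.

Theorem theorem2p10 (R : realType) (d : nat) (f : set 'rV[R]_d -> \bar R)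
    (f_ge0 : nonneg_on_convex f) (f_mono : monotone_on_convex f)
    (C : R -> nat)
    (f_approx : approximated_by_inscribed_polytopes f C)
    (f_select : admits_selection_theorem f C)
    (eps' : R) (eps'_01 : 0 < eps' < 1) :
  admits_bounded_weak_nets f eps'.
Proof.
move=> eps eps01; have [rho rho0 select] := f_select _ eps01.
have /andP[e0 _] := eps'_01; have /andP[eps0 eps1] := eps01.
set r := selection_size d C eps in select.
have r0 : (0 < r)%N by rewrite /r /selection_size leq_max orbT.
(* The fraction of the r-subsets of T that a single greedy step exhausts. *)
pose delta := rho * (eps' / r%:R) ^+ r.
have delta0 : 0 < delta by rewrite mulr_gt0 // exprn_gt0 // divr_gt0 ?ltr0n.
pose m1 := Num.bound (r%:R / eps'); pose m2 := Num.bound delta^-1.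
exists (maxn m1 m2) => lambda lambda0 T T0 Tabove.
have [small|large] := ltrP (eps' * #|` T|%:R) r%:R.
  exists T; split.
  - rewrite leq_max -(ler_nat R); apply/orP; left.
    have re0 : 0 <= r%:R / eps' by rewrite divr_ge0 // ltW.
    apply: le_trans (ltW (archi_boundP re0)).
    by rewrite ler_pdivlMr // mulrC ltW.
  - move=> K /Tabove[Kc Kl]; split=> //; apply: le_trans Kl.
    by rewrite lee_fin ger_pMl // gerBl ltW.
  move=> A /fsubsetP AT AnT; have [A0|[K KA]] := fset_0Vmem A.
    move: AnT; rewrite A0 cardfs0 leNgt mulr_gt0 // ltr0n.
    by rewrite cardfs_gt0 T0.
  exists K; first exact: AT.
  move=> x Kx M [_]; apply; exists K => //.
pose U := [fset A in fpowerset T | #|` A| == r]%fset.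
have UE : #|` U| = 'C(#|` T|, r) by exact: card_fpowerset_draws.
have rT : (r <= #|` T|)%N.
  rewrite -(ler_nat R) (le_trans large) // ger_pMl ?ltr0n ?cardfs_gt0 //.
  by have /andP[_ /ltW] := eps'_01.
pose heavy A := (A `<=` T)%fset /\ eps' * #|` T|%:R <= #|` A|%:R.
pose good K := isconvex K /\ (((1 - eps) * lambda)%:E <= f K)%E.
have m2_big : 1 < delta * m2%:R.
  by rewrite -ltr_pdivrMl // mulr1 archi_boundP // invr_ge0 ltW.
have [||//|A [AT AnT]|N [Nm Ngood Nnet]] :=
  @greedy_net R _ _ (fun K A => (K `<=` convU A)%classic) good heavy U delta m2.
- by move=> K A B AB KA x /KA; apply: subset_convU.
- by rewrite UE bin_gt0.
- have rA : (r <= #|` A|)%N by rewrite -(ler_nat R) (le_trans large).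
  have A0 : A != fset0 by rewrite -cardfs_gt0 (leq_trans r0).
  have Aabove : is_family_above f lambda A.
    by move=> K KA; apply: Tabove; exact: (fsubsetP AT).
  have [K [Kc Kl KA]] := select _ lambda0 _ A0 Aabove.
  exists K; first by rewrite /good mulrC.
  apply: (@le_trans _ _ (rho * 'C(#|` A|, r)%:R)).
    by rewrite UE -mulrA ler_pM2l // bin_dense ?r0.
  apply: le_trans KA _; rewrite ler_nat fsubset_leq_card //.
  apply/fsubsetP => B; rewrite !inE !fpowersetE /= => /and3P[BA -> ->].
  by rewrite BA (fsubset_trans BA AT).
exists N; split=> //; first by rewrite leq_max Nm orbT.
by move=> A AT AnT; apply: Nnet.
Qed.
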